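(* In a clean active periodic finite-window model, let $\Phi_\Lambda=\ker A_\Lambda^*$ be the strict trace-invisible Schur cokernel and let $$J^{\rm rel}_\Lambda s=\sum_{\sigma\in\Lambda}\mu_\sigma s_\sigma w_\sigma,\qquad \mu_\sigma=\frac{|\sigma_h|^2+\sigma_3^2}{|\sigma_h|^2}.$$ If $\Lambda$ is active, meaning $|\sigma_h|\ne0$ and $|\sigma_3|\neq0$ for every output mode $\sigma\in\Lambda$, then for $s\in\Phi_\Lambda$ $$J^{\rm rel}_\Lambda s=0\quad\Longrightarrow\quad s=0.$$ Thus a strict-invisible Schur defect need not be a true Navier--Stokes phantom; in active finite windows it is relaxed-visible through vertical pressure.
   Context: Work on the periodic box $\mathbb T^3$. $\Lambda\subset\mathbb Z^3\setminus\{0\}$ is a finite symmetric set of output Fourier modes $\sigma=(\sigma_h,\sigma_3)$, with $\sigma_h\in\mathbb Z^2$ horizontal and $\sigma_3\in\mathbb Z$ vertical. $Y_\Lambda$ is the finite-dimensional reduced Schur quotient with basis $(q_\sigma)_{\sigma\in\Lambda}$, and vectors are written $s=\sum_{\sigma\in\Lambda}s_\sigma q_\sigma$. $A_\Lambda:H_\Lambda\to Y_\Lambda$ is the linear trace-defect map from the finite-dimensional space $H_\Lambda$ of selected-time strict trace corrections, so $\Phi_\Lambda=\ker A_\Lambda^*=(\operatorname{Range}A_\Lambda)^\perp\subset Y_\Lambda$ consists of the vectors invisible to strict trace corrections (strict-invisible Schur defects). $W_\Lambda$ is the space of vertical-pressure residuals with basis $(w_\sigma)_{\sigma\in\Lambda}$,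 and $J^{\rm rel}_\Lambda:\Phi_\Lambda\to W_\Lambda$ is the relaxed vertical-pressure observation. Its multiplier arises as follows: a horizontal pressure-forcing coefficient $\beta_\sigma$ produces a vertical pressure derivative of modulus $\Theta_\sigma|\beta_\sigma|$ with $\Theta_\sigma=|\sigma_3|/|\sigma|^2$, while the Schur coefficient is normalized as $s_\sigma=\Gamma_\sigma\beta_\sigma$ with $\Gamma_\sigma=|\sigma_3||\sigma_h|^2/|\sigma|^4$ (up to nonzero phases), and $\mu_\sigma=\Theta_\sigma/\Gamma_\sigma$. A nonzero Schur defect is relaxed-visible if it is seen by the vertical pressure residual, i.e. by $J^{\rm rel}_\Lambda$; a true phantom is a nonzero Schur defect that is visible neither to strict trace variations nor to the relaxed vertical-pressure observation. *)

(* Defs.v *)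
From HB Require Import structures.
From mathcomp Require Import all_boot all_order all_algebra.
From mathcomp Require Import finmap complex reals ring.

Set Implicit Arguments.
Unset Strict Implicit.
Unset Printing Implicit Defensive.

Import Order.TTheory GRing.Theory Num.Theory Num.Def.
Local Open Scope ring_scope.
Local Open Scope complex_scope.

(** A mode sigma = (sigma_h, sigma_3), with sigma_h in Z^2 and sigma_3 in Z. *)
Notation mode := ((int * int) * int)%type.

Section Symbols.
Variable R : realType.
Implicit Type sigma : mode.

Definition horizontal_norm sigma : R :=
  Num.sqrt (sigma.1.1%:~R ^+ 2 + sigma.1.2%:~R ^+ 2).

Definition vertical_norm sigma : R := `|sigma.2%:~R|.

Definition mode_norm sigma : R :=
  Num.sqrt (sigma.1.1%:~R ^+ 2 + sigma.1.2%:~R ^+ 2 + sigma.2%:~R ^+ 2).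

Definition Theta sigma : R := vertical_norm sigma / mode_norm sigma ^+ 2.

Definition Gamma sigma : R :=
  vertical_norm sigma * horizontal_norm sigma ^+ 2 / mode_norm sigma ^+ 4.

Definition mu sigma : R :=
  (horizontal_norm sigma ^+ 2 + sigma.2%:~R ^+ 2) / horizontal_norm sigma ^+ 2.

Definition active_mode sigma : Prop :=
  horizontal_norm sigma != 0 /\ vertical_norm sigma != 0.

Lemma mode_norm_sqr sigma :
  mode_norm sigma ^+ 2 = horizontal_norm sigma ^+ 2 + sigma.2%:~R ^+ 2.
Proof. by rewrite !sqr_sqrtr// ?addr_ge0// sqr_ge0. Qed.

Lemma mu_Theta_Gamma sigma :
  active_mode sigma -> mu sigma = Theta sigma / Gamma sigma.
Proof.
case=> h0 v0; rewrite /mu -mode_norm_sqr /Theta /Gamma.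
have m0 : mode_norm sigma ^+ 2 != 0.
  rewrite mode_norm_sqr gt_eqF// ltr_wpDr ?sqr_ge0//.
  by rewrite lt_def sqrf_eq0 h0 sqr_ge0.
rewrite -[4%N]/(2 * 2)%N exprM.
by field; rewrite h0 v0 -sqrf_eq0 m0.
Qed.

End Symbols.

Section Adjoint.
Variables (C : numClosedFieldType) (U V : vectType C).
Variables (dotU : {dot U for conjC}) (dotV : {dot V for conjC}).
Variable f : 'Hom(U, V).

Let b : (\dim {:U}).-tuple U := vbasis {:U}.

Definition gram_mx : 'M[C]_(\dim {:U}) := \matrix_(i, j) dotU b`_i b`_j.

(* The coordinates of [f^* y] in the basis [b] solve the normal equations
   [dotU (f^* y) b_j = dotV y (f b_j)]. *)
Definition adjoint_fun (y : V) : U :=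
  \sum_(i < \dim {:U}) ((\row_(j < \dim {:U}) dotV y (f b`_j)) *m invmx gram_mx) ord0 i *: b`_i.

Fact adjoint_fun_is_linear : linear adjoint_fun.
Proof.
move=> a y z; rewrite /adjoint_fun scaler_sumr -big_split; apply: eq_bigr => i _.
rewrite /= scalerA -scalerDl; congr (_ *: _).
have -> : \row_(j < \dim {:U}) dotV (a *: y + z) (f b`_j) =
    a *: (\row_(j < \dim {:U}) dotV y (f b`_j)) + \row_(j < \dim {:U}) dotV z (f b`_j).
  by apply/rowP => j; rewrite !mxE linearPl.
by rewrite mulmxDl -scalemxAl !mxE.
Qed.
HB.instance Definition _ := GRing.isLinear.Build C V U _ adjoint_fun
  adjoint_fun_is_linear.

Definition adjoint : 'Hom(V, U) := linfun adjoint_fun.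

Lemma gram_unit : gram_mx \in unitmx.
Proof.
rewrite -row_free_unit; apply/row_freeP; apply/row_freeP.
apply/inj_row_free => u uG0.
pose x := \sum_(i < \dim {:U}) u ord0 i *: b`_i.
have xb (j : 'I_(\dim {:U})) : dotU x b`_j = 0.
  have /rowP/(_ j) := uG0; rewrite !mxE => <-.
  rewrite /x linear_sumlz; apply: eq_bigr => i _.
  by rewrite linearZl_LR !mxE.
have x0 : x = 0.
  apply/eqP; rewrite -(dnorm_eq0 dotU) {2}/x linear_sumr big1// => i _.
  by rewrite linearZr_LR /= xb mulr0.
have /freeP fb : free b := basis_free (vbasisP _).
by apply/rowP => i; rewrite mxE (fb (u ord0) x0).
Qed.

Lemma adjointP (x : U) (y : V) : dotU (adjoint y) x = dotV y (f x).
Proof.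
have adjb j : dotU (adjoint y) b`_j = dotV y (f b`_j) => [|].
  rewrite lfunE /= /adjoint_fun linear_sumlz.
  set v := (X in X *m _).
  have : v *m invmx gram_mx *m gram_mx = v by rewrite mulmxKV// gram_unit.
  case: (ltnP j (\dim {:U})) => [jd|dj]; last first.
    move=> _; rewrite nth_default ?size_tuple// linear0 linear0r.
    by rewrite big1// => i _; rewrite linear0r.
  move=> /rowP/(_ (Ordinal jd)); rewrite [RHS]mxE /= => <-.
  by rewrite mxE; apply: eq_bigr => i _; rewrite linearZl_LR !mxE.
rewrite (coord_vbasis (memvf x)) linear_sumr linear_sum linear_sumr.
by apply: eq_bigr => i _; rewrite !linearZ /= adjb.
Qed.

Lemma lker_adjoint : lker adjoint = orthov dotV (limg f).
Proof.
apply/vspaceP => y; rewrite memv_ker; apply/eqP/mem_orthovP.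
  move=> y0 _ /memv_imgP[x _ ->]; apply: etrans (esym (adjointP x y)) _.
  by rewrite y0 linear0l.
move=> yA; apply/eqP; rewrite -(dnorm_eq0 dotU) adjointP.
by apply/eqP; apply: yA; rewrite memv_img// memvf.
Qed.

Lemma mem_lker_adjoint (y : V) :
  y \in lker adjoint <-> ~ exists x, dotV (f x) y != 0.
Proof.
rewrite lker_adjoint; split.
  move=> /mem_orthovP yA [x]; rewrite herm_eq0C => /eqP; apply; apply: yA.
  by rewrite memv_img// memvf.
move=> yV; apply/mem_orthovP => _ /memv_imgP[x _ ->]; apply/eqP.
by rewrite herm_eq0C; apply/negPn/negP => xy; apply: yV; exists x.
Qed.

End Adjoint.

(** The trace-correction space, the Schur quotient and the space of
    vertical-pressure residuals enter only through the data below; the bases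
    [schur_basis] and [residual_basis] are not assumed to be orthonormal. *)
Record finite_window_model (R : realType) := FiniteWindowModel {
  modes : {fset mode};
  modes_neq0 : 0 \notin modes;
  modes_sym : forall sigma, sigma \in modes -> - sigma \in modes;
  trace_space : vectType R[i];
  trace_dot : {dot trace_space for conjC};
  schur_space : vectType R[i];
  schur_dot : {dot schur_space for conjC};
  schur_basis : modes -> schur_space;
  schur_basisP : basis_of {:schur_space} (codom schur_basis);
  residual_space : vectType R[i];
  residual_basis : modes -> residual_space;
  residual_basisP : basis_of {:residual_space} (codom residual_basis);
  trace_defect : 'Hom(trace_space, schur_space)
}.

Section Model.
Variables (R : realType) (M : finite_window_model R).

Definition active : Prop := forall sigma : mode,
  sigma \in modes M -> active_mode R sigma.

Definition schur_coord (sigma : modes M) (s : schur_space M) : R[i] :=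
  coord (codom_tuple (schur_basis (f:=M))) (enum_rank sigma) s.

Lemma schur_coordE (s : schur_space M) :
  s = \sum_(sigma : modes M) schur_coord sigma s *: schur_basis sigma.
Proof.
rewrite {1}(coord_basis (schur_basisP M) (memvf s)).
rewrite (reindex_onto enum_rank enum_val) => [|i _]; last exact: enum_valK.
apply: eq_big => sigma; first by rewrite enum_rankK eqxx.
by move=> _; rewrite /schur_coord nth_codom enum_rankK.
Qed.

Definition strict_visible (s : schur_space M) : Prop :=
  exists h, schur_dot M (trace_defect M h) s != 0.

Definition Phi : {vspace schur_space M} :=
  lker (adjoint (trace_dot M) (schur_dot M) (trace_defect M)).

Lemma PhiE : Phi = orthov (schur_dot M) (limg (trace_defect M)).
Proof. exact: lker_adjoint. Qed.

Lemma PhiP (s : schur_space M) : s \in Phi <-> ~ strict_visible s.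
Proof. exact: mem_lker_adjoint. Qed.

Definition Jrel (s : subvs_of Phi) : residual_space M :=
  \sum_(sigma : modes M)
    ((mu R (val sigma))%:C * schur_coord sigma (vsval s)) *: residual_basis sigma.

Fact Jrel_is_linear : linear Jrel.
Proof.
move=> a s t; rewrite /Jrel scaler_sumr -big_split; apply: eq_bigr => sigma _.
by rewrite /= /schur_coord !linearP /= scalerA -scalerDl mulrDr mulrCA.
Qed.
HB.instance Definition _ :=
  GRing.isLinear.Build R[i] (subvs_of Phi) (residual_space M) _ Jrel
    Jrel_is_linear.

Definition relaxed_visible (s : schur_space M) : Prop :=
  s != 0 /\ exists2 t : subvs_of Phi, vsval t = s & Jrel t != 0.

Definition true_phantom (s : schur_space M) : Prop :=
  [/\ s != 0, ~ strict_visible s & ~ relaxed_visible s].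

End Model.

(* Main.v *)
(** The observation [Jrel] is diagonal in the mode bases, and on an active
    window each multiplier [mu] is nonzero because its numerator is at least
    its (nonzero) denominator; comparing coefficients in the residual basis then
    recovers every Schur coefficient. *)

Require Import Defs.
From mathcomp Require Import all_boot all_order all_algebra.
From mathcomp Require Import finmap complex reals.
Import GRing.Theory.
Local Open Scope ring_scope.

Lemma mu_neq0 (R : realType) (sigma : mode) :
  horizontal_norm R sigma != 0 -> mu R sigma != 0.
Proof.
move=> h0; rewrite /mu mulf_neq0 ?invr_neq0 ?expf_neq0//.
by rewrite Num.Theory.paddr_eq0 ?Num.Theory.sqr_ge0// negb_and expf_neq0.
Qed.

Lemma residual_basis_free (R : realType) (M : finite_window_model R)
    (k : modes M -> R[i]) :
  \sum_(sigma : modes M) k sigma *: residual_basis sigma = 0 ->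
  forall sigma, k sigma = 0.
Proof.
move=> k0 sigma.
have /freeP fw : free (codom_tuple (residual_basis (f:=M))).
  exact: basis_free (residual_basisP M).
(* [freeP] speaks of ordinal-indexed families, so [k] is transported along the enumeration of the
   modes. *)
rewrite -[sigma]enum_rankK; apply: (fw (k \o enum_val)).
rewrite -[RHS]k0 [RHS](reindex_onto enum_val enum_rank); last first.
  by move=> ? _; exact: enum_rankK.
apply: eq_big => i; first by rewrite enum_valK eqxx.
by rewrite nth_codom.
Qed.

Lemma Jrel_eq0 (R : realType) (M : finite_window_model R) (s : subvs_of (Phi M)) :
  active M -> Jrel s = 0 -> s = 0.
Proof.
move=> act /residual_basis_free Js0; apply: val_inj.
rewrite [LHS]schur_coordE big1// => sigma _.
have [h0 _] := act _ (valP sigma).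
(* The embedding of [R] into [R[i]] is injective, so the nonzero real [mu] stays nonzero and
   cancels. *)
move/eqP: (Js0 sigma); rewrite mulf_eq0 fmorph_eq0 (negPf (mu_neq0 _ _ h0)) /=.
by move=> /eqP ->; rewrite scale0r.
Qed.

Theorem theorem1p3 (R : realType) (M : finite_window_model R) :
  active M ->
  (forall s : subvs_of (Phi M), Jrel s = 0 -> s = 0) /\
  (forall s : schur_space M, s \in Phi M -> s != 0 ->
     relaxed_visible s /\ ~ true_phantom s).
Proof.
move=> act; split=> [s|s sPhi s0]; first exact: Jrel_eq0.
have vis : relaxed_visible s.
  (* [Jrel] lives on [Phi M], so the witness is [s] paired with its membership proof; a vanishing
     observation would force [s = 0]. *)
  split=> //; exists (Subvs sPhi) => //.
  apply: contra s0 => /eqP /(Jrel_eq0 _ _ _ act) /(congr1 vsval) /= ->; exact: eqxx.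
by split=> // -[].
Qed.
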